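(* Let $X,Y$ be compact convex sets, $d_g$ and $d_h$ Bregman divergences on $X$ and $Y$ respectively, and let $f:X\times Y\to\mathbb{R}$ be $(L_X,L_Y)$-convex-concave with respect to $(d_g,d_h)$. Suppose $f$ has a saddle point $(\mathbf{x}^*,\mathbf{y}^* )$. Let $(\mathbf{x}^0,\mathbf{y}^0)\in\mathrm{rint}(X)\times\mathrm{rint}(Y)$ and for $t\ge0$ $$\mathbf{x}^{t+1}=\arg\min_{\mathbf{x}\in X}\{\langle\nabla_{\mathbf{x}}f(\mathbf{x}^t,\mathbf{y}^t),\mathbf{x}-\mathbf{x}^t\rangle+2L_X\,d_g(\mathbf{x},\mathbf{x}^t)\},$$ $$\mathbf{y}^{t+1}=\arg\min_{\mathbf{y}\in Y}\{\langle-\nabla_{\mathbf{y}}f(\mathbf{x}^t,\mathbf{y}^t),\mathbf{y}-\mathbf{y}^t\rangle+2L_Y\,d_h(\mathbf{y},\mathbf{y}^t)\}.$$ Then for every $T\ge1$: (i) $\displaystyle\sum_{t=1}^T\left(f(\mathbf{x}^t,\mathbf{y}^* )-f(\mathbf{x}^*,\mathbf{y}^t)\right)\le2L_X\,d_g(\mathbf{x}^*,\mathbf{x}^0)+2L_Y\,d_h(\mathbf{y}^*,\mathbf{y}^0)$; (ii) with $\bar{\mathbf{x}}=\frac1T\sum_{t=1}^T\mathbf{x}^t$ and $\bar{\mathbf{y}}=\frac1T\sum_{t=1}^T\mathbf{y}^t$, $$f(\bar{\mathbf{x}},\mathbf{y}^* )-f(\mathbf{x}^*,\bar{\mathbf{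y}})\le\frac1T\left[2L_X\,d_g(\mathbf{x}^*,\mathbf{x}^0)+2L_Y\,d_h(\mathbf{y}^*,\mathbf{y}^0)\right].$$
   Context: For a differentiable convex function $h$ on a compact convex set $C$, the Bregman divergence is $d_h(\mathbf{x},\mathbf{y})=h(\mathbf{x})-h(\mathbf{y})-\langle\nabla h(\mathbf{y}),\mathbf{x}-\mathbf{y}\rangle$ for $\mathbf{x}\in C$, $\mathbf{y}\in\mathrm{rint}(C)$ (relative interior). $f$ is differentiable on $\mathrm{rint}(X)\times\mathrm{rint}(Y)$. It is understood that the iterates exist and lie in the relative interiors, so the updates are well defined. Definition: $f$ is $(L_X,L_Y)$-convex-concave w.r.t. $(d_g,d_h)$ if $f(\cdot,\mathbf{y})$ is convex for each fixed $\mathbf{y}$, $f(\mathbf{x},\cdot)$ is concave for each fixed $\mathbf{x}$, and $L_X,L_Y>0$ satisfy, for all $\mathbf{x}\in X$, $\mathbf{y}\in Y$, $\mathbf{x}'\in\mathrm{rint}(X)$, $\mathbf{y}'\in\mathrm{rint}(Y)$, $$-L_Y\,d_h(\mathbf{y},\mathbf{y}')\le f(\mathbf{x},\mathbf{y})-f(\mathbf{x}',\mathbf{y}')-\langle\nabla f(\mathbf{x}',\mathbf{y}'),(\mathbf{x},\mathbf{y})-(\mathbf{x}',\mathbf{y}')\rangle\le L_X\,d_g(\mathbf{x},\mathbf{x}').$$ $(\mathbf{x}^*,\mathbf{y}^* )$ is a saddle point of $f$ if $f(\mathbf{x},\mathbf{y}^* )\ge f(\mathbf{x}^*,\mathbf{y}^*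 )\ge f(\mathbf{x}^*,\mathbf{y})$ for all $\mathbf{x}\in X$, $\mathbf{y}\in Y$. *)

(* Defs.v *)
From HB Require Import structures.
From mathcomp Require Import all_boot all_order all_algebra.
From mathcomp Require Import all_classical all_reals all_analysis.

Set Implicit Arguments.
Unset Strict Implicit.
Unset Printing Implicit Defensive.

Import Order.TTheory GRing.Theory Num.Theory.
Import numFieldNormedType.Exports.

Local Open Scope classical_set_scope.
Local Open Scope ring_scope.

Definition dotv (R : realType) (n : nat) (u v : 'rV[R]_n) : R :=
  \sum_(i < n) u 0 i * v 0 i.

Definition affine_hull (R : realType) (n : nat) (C : set 'rV[R]_n) :
    set 'rV[R]_n :=
  [set z | exists k (a : 'I_k -> R) (p : 'I_k -> 'rV[R]_n),
    [/\ \sum_i a i = 1, forall i, C (p i) & z = \sum_i a i *: p i]].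

Definition rint (R : realType) (n : nat) (C : set 'rV[R]_n) : set 'rV[R]_n :=
  [set x | C x /\ \forall z \near x, affine_hull C z -> C z].

(* A function on C is represented by a total function whose values outside C
   are irrelevant, so differentiability is the Frechet condition for increments
   that stay in C.  This is the intrinsic notion when C is not
   full-dimensional: no extension of h off C, or off its affine hull, is
   involved. *)
Definition is_rgradient (R : realType) (n : nat) (C : set 'rV[R]_n)
    (h : 'rV[R]_n -> R) (y v : 'rV[R]_n) : Prop :=
  (fun z => h z - h y - dotv v (z - y) : R^o)
    =o_ (within C (nbhs y)) (fun z => z - y).

Definition rdifferentiable (R : realType) (n : nat) (C : set 'rV[R]_n)
    (h : 'rV[R]_n -> R) (y : 'rV[R]_n) : Prop :=
  exists v, is_rgradient C h y v.

(* For C convex and y in C, two vectors satisfying [is_rgradient C h y] have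
   the same inner product with every x - y, x in C; gradients are paired with
   vectors of this form, or differences of them, only.  When C has nonempty
   interior the gradient at a point of the interior is unique. *)
Definition rgradient (R : realType) (n : nat) (C : set 'rV[R]_n)
    (h : 'rV[R]_n -> R) (y : 'rV[R]_n) : 'rV[R]_n :=
  get [set v | is_rgradient C h y v].

Definition bregman (R : realType) (n : nat) (C : set 'rV[R]_n)
    (h : 'rV[R]_n -> R) (x y : 'rV[R]_n) : R :=
  h x - h y - dotv (rgradient C h y) (x - y).

(* [bregman C h] is a Bregman divergence on C when h satisfies this; h need not
   be differentiable on the relative boundary (e.g. the negative entropy). *)
Definition bregman_generator (R : realType) (n : nat) (C : set 'rV[R]_n)
    (h : 'rV[R]_n -> R) : Prop :=
  convex_function C h /\ forall y, rint C y -> rdifferentiable C h y.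

(* R^n x R^m is identified with R^(n+m): the pair (x, y) is [row_mx x y]. *)
Definition pairset (R : realType) (n m : nat) (X : set 'rV[R]_n)
    (Y : set 'rV[R]_m) : set 'rV[R]_(n + m) :=
  [set z | X (lsubmx z) /\ Y (rsubmx z)].

Definition joint (R : realType) (n m : nat) (f : 'rV[R]_n -> 'rV[R]_m -> R)
    (z : 'rV[R]_(n + m)) : R :=
  f (lsubmx z) (rsubmx z).

Definition convex_concave_wrt (R : realType) (n m : nat)
    (X : set 'rV[R]_n) (Y : set 'rV[R]_m) (g : 'rV[R]_n -> R)
    (h : 'rV[R]_m -> R) (LX LY : R) (f : 'rV[R]_n -> 'rV[R]_m -> R) : Prop :=
  [/\ forall y, Y y -> convex_function X (fun x => f x y),
      forall x, X x -> convex_function Y (fun y => - f x y),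
      0 < LX, 0 < LY &
      forall x y x' y', X x -> Y y -> rint X x' -> rint Y y' ->
        - LY * bregman Y h y y'
          <= f x y - f x' y'
             - dotv (rgradient (pairset X Y) (joint f) (row_mx x' y'))
                    (row_mx x y - row_mx x' y')
          <= LX * bregman X g x x'].

Definition saddle_point (R : realType) (n m : nat)
    (X : set 'rV[R]_n) (Y : set 'rV[R]_m) (f : 'rV[R]_n -> 'rV[R]_m -> R)
    (xs : 'rV[R]_n) (ys : 'rV[R]_m) : Prop :=
  [/\ X xs, Y ys &
      forall x y, X x -> Y y -> f x ys >= f xs ys /\ f xs ys >= f xs y].

Definition is_argmin (R : realType) (n : nat) (C : set 'rV[R]_n)
    (phi : 'rV[R]_n -> R) (x : 'rV[R]_n) : Prop :=
  C x /\ forall w, C w -> phi x <= phi w.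

(* Main.v *)
Require Import Defs.
From mathcomp Require Import all_boot all_order all_algebra.
From mathcomp Require Import all_classical all_reals all_analysis.
From mathcomp Require Import ring lra.
Import Order.TTheory GRing.Theory Num.Theory.
Import numFieldNormedType.Exports.
Local Open Scope classical_set_scope.
Local Open Scope ring_scope.

(* Taking (x^(t+1), y* ) in the upper bound and (x*, y^(t+1)) in the lower bound
   of the convex-concave condition at (x^t, y^t) and subtracting, the gap
   f(x^(t+1), y* ) - f(x*, y^(t+1)) is at most
     <grad_x f, x^(t+1) - x*> + <grad_y f, y* - y^(t+1)>
       + L_X d_g(x^(t+1), x^t) + L_Y d_h(y^(t+1), y^t).
   By first-order optimality of the updates and the three-point identity, the
   inner products are at most
     2 L_X (d_g(x*, x^t) - d_g(x*, x^(t+1)) - d_g(x^(t+1), x^t))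
   and its analogue in y.  The divergences between consecutive iterates are
   nonnegative and come with negative total sign, so the gaps telescope; (ii)
   follows from (i) by Jensen. *)

Set Implicit Arguments.
Unset Strict Implicit.

(** * Bilinearity of the inner product *)

Section Dotv.
Context {R : realType} {n : nat}.
Implicit Types u v w : 'rV[R]_n.

Lemma dotvDl u v w : dotv (u + v) w = dotv u w + dotv v w.
Proof. by rewrite -big_split; apply: eq_bigr => i _; rewrite mxE mulrDl. Qed.

Lemma dotvDr u v w : dotv u (v + w) = dotv u v + dotv u w.
Proof. by rewrite -big_split; apply: eq_bigr => i _; rewrite mxE mulrDr. Qed.

Lemma dotvNl u v : dotv (- u) v = - dotv u v.
Proof. by rewrite -sumrN; apply: eq_bigr => i _; rewrite mxE mulNr. Qed.

Lemma dotvZr u (s : R) v : dotv u (s *: v) = s * dotv u v.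
Proof. by rewrite mulr_sumr; apply: eq_bigr => i _; rewrite mxE mulrCA. Qed.

Lemma dotvZl (s : R) u v : dotv (s *: u) v = s * dotv u v.
Proof. by rewrite mulr_sumr; apply: eq_bigr => i _; rewrite mxE mulrA. Qed.

Lemma dotvNr u v : dotv u (- v) = - dotv u v.
Proof. by rewrite -scaleN1r dotvZr mulN1r. Qed.

Lemma dotvBr u v w : dotv u (v - w) = dotv u v - dotv u w.
Proof. by rewrite dotvDr dotvNr. Qed.

Lemma dotv0r u : dotv u 0 = 0.
Proof. by rewrite -(scale0r 0) dotvZr mul0r. Qed.

End Dotv.

(** * Gradients on a product and on its slices *)

Lemma dotv_row_mx (R : realType) (n m : nat) (v : 'rV[R]_(n + m))
    (a : 'rV[R]_n) (b : 'rV[R]_m) :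
  dotv v (row_mx a b) = dotv (lsubmx v) a + dotv (rsubmx v) b.
Proof.
rewrite /dotv big_split_ord; congr (_ + _); apply: eq_bigr => i _.
  by rewrite row_mxEl mxE.
by rewrite row_mxEr mxE.
Qed.

Lemma norm_row_mxr0 (R : realType) (n m : nat) (u : 'rV[R]_n) :
  `|row_mx u (0 : 'rV[R]_m)| <= `|u|.
Proof.
rewrite /Num.Def.normr/= !mx_normrE.
apply: bigmax_le => [|[i j] _ /=]; first exact: bigmax_ge_id.
rewrite mxE; case: splitP => k _; last by rewrite mxE normr0 bigmax_ge_id.
exact: (le_bigmax _ (fun ij => `|u ij.1 ij.2|) (i, k)).
Qed.

Lemma norm_row_mx0l (R : realType) (n m : nat) (u : 'rV[R]_m) :
  `|row_mx (0 : 'rV[R]_n) u| <= `|u|.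
Proof.
rewrite /Num.Def.normr/= !mx_normrE.
apply: bigmax_le => [|[i j] _ /=]; first exact: bigmax_ge_id.
rewrite mxE; case: splitP => k _; first by rewrite mxE normr0 bigmax_ge_id.
exact: (le_bigmax _ (fun ij => `|u ij.1 ij.2|) (i, k)).
Qed.

Lemma is_rgradientP (R : realType) (n : nat) (C : set 'rV[R]_n)
    (h : 'rV[R]_n -> R) (y v : 'rV[R]_n) :
  is_rgradient C h y v <->
  forall e : R, 0 < e -> exists2 d : R, 0 < d & forall z, C z ->
    `|z - y| < d -> `|h z - h y - dotv v (z - y)| <= e * `|z - y|.
Proof.
rewrite /is_rgradient; split => [/eqoP H e e0|H].
  have /nbhs_normP[d /= d0 Hd] : \forall z \near y, C z ->
    `|h z - h y - dotv v (z - y)| <= e * `|z - y| := H e e0.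
  by exists d => // z Cz zd; apply: Hd => //=; rewrite distrC.
apply/eqoP => e e0; have [d d0 Hd] := H e e0.
suff : \forall z \near y, C z ->
    `|h z - h y - dotv v (z - y)| <= e * `|z - y| by [].
by apply/nbhs_normP; exists d => // z /= zd Cz; apply: Hd => //; rewrite distrC.
Qed.

Lemma rgradientP (R : realType) (n : nat) (C : set 'rV[R]_n)
    (h : 'rV[R]_n -> R) (y : 'rV[R]_n) :
  rdifferentiable C h y -> is_rgradient C h y (rgradient C h y).
Proof. by case=> v; exact: getI. Qed.

(** On the slice through [y] an increment is [row_mx (z - x) 0]: it pairs only with the left block
    of [v], and zero padding does not increase the max norm, so the same radius works. *)
Lemma is_rgradient_joint_l (R : realType) (n m : nat) (X : set 'rV[R]_n)
    (Y : set 'rV[R]_m) (f : 'rV[R]_n -> 'rV[R]_m -> R) (x : 'rV[R]_n)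
    (y : 'rV[R]_m) (v : 'rV[R]_(n + m)) :
  Y y -> is_rgradient (pairset X Y) (joint f) (row_mx x y) v ->
  is_rgradient X (f^~ y) x (lsubmx v).
Proof.
move=> Yy /is_rgradientP fv; apply/is_rgradientP => e e0.
have [d d0 hd] := fv e e0; exists d => // z Xz zd.
have := hd (row_mx z y); rewrite opp_row_mx add_row_mx subrr.
rewrite /joint /pairset/= !row_mxKl !row_mxKr dotv_row_mx dotv0r addr0.
move=> /(_ (conj Xz Yy) (le_lt_trans (norm_row_mxr0 _ _) zd)) H.
by apply: (le_trans H); rewrite ler_wpM2l ?norm_row_mxr0// ltW.
Qed.

Lemma is_rgradient_joint_r (R : realType) (n m : nat) (X : set 'rV[R]_n)
    (Y : set 'rV[R]_m) (f : 'rV[R]_n -> 'rV[R]_m -> R) (x : 'rV[R]_n)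
    (y : 'rV[R]_m) (v : 'rV[R]_(n + m)) :
  X x -> is_rgradient (pairset X Y) (joint f) (row_mx x y) v ->
  is_rgradient Y (f x) y (rsubmx v).
Proof.
move=> Xx /is_rgradientP fv; apply/is_rgradientP => e e0.
have [d d0 hd] := fv e e0; exists d => // z Yz zd.
have := hd (row_mx x z); rewrite opp_row_mx add_row_mx subrr.
rewrite /joint /pairset/= !row_mxKl !row_mxKr dotv_row_mx dotv0r add0r.
move=> /(_ (conj Xx Yz) (le_lt_trans (norm_row_mx0l _ _) zd)) H.
by apply: (le_trans H); rewrite ler_wpM2l ?norm_row_mx0l// ltW.
Qed.

(** * First-order calculus on a convex set *)

Section Convex.
Context {R : realType} {n : nat} {C : set 'rV[R]_n}.
Hypothesis cvxC : convex_set C.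
Implicit Types (h : 'rV[R]_n -> R) (w y v : 'rV[R]_n).

Lemma conv_segment (w y : 'rV[R]_n) (s : R) (s0 : 0 <= s) (s1 : s <= 1) :
  conv (Itv01 s0 s1) (w : convex_lmodType 'rV[R]_n) y = y + s *: (w - y).
Proof.
by rewrite /conv/= /unstable.onem scalerBl scale1r scalerBr addrCA.
Qed.

Lemma convex_set_segment w y (s : R) :
  C w -> C y -> 0 <= s -> s <= 1 -> C (y + s *: (w - y)).
Proof.
move=> Cw Cy s0 s1; have := @cvxC w y (Itv01 s0 s1); rewrite conv_segment !inE.
exact.
Qed.

Lemma convex_function_segment h w y (s : R) :
  convex_function C h -> C w -> C y -> 0 <= s -> s <= 1 ->
  h (y + s *: (w - y)) <= h y + s * (h w - h y).
Proof.
move=> cvxh Cw Cy s0 s1; have := cvxh (Itv01 s0 s1) w y.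
rewrite !inE conv_segment convRE/= /unstable.onem => /(_ Cw Cy) H.
by apply: (le_trans H); rewrite le_eqVlt; apply/orP; left; apply/eqP; ring.
Qed.

(** Jensen by induction: each new mean lies on the segment from the previous mean [q] to the new
    point, at parameter [s = 1 / (N + 2)]. *)
Lemma convex_mean h (p : nat -> 'rV[R]_n) (N : nat) :
  convex_function C h -> (forall t, C (p t)) ->
  C (N.+1%:R^-1 *: \sum_(t < N.+1) p t) /\
  h (N.+1%:R^-1 *: \sum_(t < N.+1) p t)
    <= N.+1%:R^-1 * \sum_(t < N.+1) h (p t).
Proof.
move=> cvxh Cp; elim: N => [|N [IHC IHh]].
  by rewrite !big_ord1 invr1 scale1r mul1r.
rewrite big_ord_recr/= [in leRHS]big_ord_recr/=.
set q := N.+1%:R^-1 *: _ in IHC IHh; set s : R := N.+2%:R^-1.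
have s0 : 0 <= s by rewrite invr_ge0.
have s1 : s <= 1 by rewrite invf_le1// ler1n.
have sE : 1 - s = s * N.+1%:R.
  have : s * N.+2%:R = 1 by apply: mulVf; rewrite pnatr_eq0.
  by rewrite -natr1 mulrDr mulr1 => /(canRL (addrK _)) ->.
have -> : s *: (\sum_(i < N.+1) p i + p N.+1) = q + s *: (p N.+1 - q).
  rewrite scalerBr addrCA scalerDr addrC; congr (_ + _).
  by rewrite -[X in X - _]scale1r -scalerBl sE scalerA -mulrA mulfV ?pnatr_eq0// mulr1.
split; first exact: convex_set_segment.
apply: (le_trans (convex_function_segment cvxh (Cp _) IHC s0 s1)).
have -> : h q + s * (h (p N.+1) - h q) = s * N.+1%:R * h q + s * h (p N.+1).
  by rewrite -sE; ring.
rewrite mulrDr lerD2r -mulrA ler_wpM2l//.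
by rewrite -ler_pdivlMl.
Qed.

(** The gradient expansion along the segment from [y] to [w], which convexity keeps inside [C]. The
    error is linear in [s], so dividing by [s] later gives one-sided directional derivatives. *)
Lemma is_rgradient_dir h w y v (e : R) :
  is_rgradient C h y v -> C w -> C y -> 0 < e ->
  exists d : R, [/\ 0 < d, d <= 1 & forall s, 0 < s -> s <= d ->
    `|h (y + s *: (w - y)) - h y - s * dotv v (w - y)| <= s * e].
Proof.
move=> /is_rgradientP hv Cw Cy e0.
(* Adding 1 keeps the divisor positive even when [w = y]. *)
have N0 : 0 < `|w - y| + 1 by rewrite ltr_wpDl.
have [d d0 hd] := hv (e / (`|w - y| + 1)) (divr_gt0 e0 N0).
(* The bound 1 stays on the segment; halving [d] gives the strict inequality required by [hd]. *)
exists (Num.min 1 (d / 2 / (`|w - y| + 1))); split.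
- by rewrite lt_min ltr01 !divr_gt0.
- by rewrite ge_min lexx.
move=> s s0; rewrite le_min ler_pdivlMr// => /andP[s1 sd].
have := hd _ (convex_set_segment Cw Cy (ltW s0) s1).
rewrite [y + _]addrC addrK normrZ gtr0_norm// dotvZr => H.
have {}H := H _; apply: (le_trans (H _)).
  have : s * `|w - y| <= s * (`|w - y| + 1) by rewrite ler_wpM2l ?lerDl// ltW.
  by move=> /le_trans/(_ sd)/le_lt_trans; apply; lra.
rewrite mulrCA ler_wpM2l ?(ltW s0)//.
by rewrite -mulrAC ler_pdivrMr// ler_wpM2l ?(ltW e0)// lerDl.
Qed.

(** Both sides are the derivative of [h] at [y] towards [w]. This makes the arbitrary choice in
    [rgradient] harmless along feasible directions. *)
Lemma is_rgradient_unique h w y v v' :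
  is_rgradient C h y v -> is_rgradient C h y v' -> C w -> C y ->
  dotv v (w - y) = dotv v' (w - y).
Proof.
wlog suff le_dotv : v v' / is_rgradient C h y v -> is_rgradient C h y v' ->
    C w -> C y -> dotv v (w - y) <= dotv v' (w - y).
  by move=> hv hv' Cw Cy; apply: le_anti; rewrite !le_dotv.
move=> hv hv' Cw Cy; apply/ler_addgt0Pr => e e0.
have e20 : 0 < e / 2 by rewrite divr_gt0.
have [d [d0 _ hd]] := is_rgradient_dir hv Cw Cy e20.
have [d' [d'0 _ hd']] := is_rgradient_dir hv' Cw Cy e20.
have s0 : 0 < Num.min d d' by rewrite lt_min d0.
have := hd _ s0; have := hd' _ s0; rewrite !ge_min !lexx orbT.
set s := Num.min d d' in s0 *.
move=> /(_ isT); rewrite ler_distlC => /andP[H' _].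
move=> /(_ isT); rewrite ler_distlC => /andP[_ H].
rewrite -(ler_pM2l s0); lra.
Qed.

(** Convexity bounds the difference quotients along the segment by [h w - h y]; the directional
    derivative is their limit. *)
Lemma is_rgradient_le h w y v :
  convex_function C h -> is_rgradient C h y v -> C w -> C y ->
  dotv v (w - y) <= h w - h y.
Proof.
move=> cvxh hv Cw Cy; apply/ler_addgt0Pr => e e0.
have [s [s0 s1 hs]] := is_rgradient_dir hv Cw Cy e0.
have := convex_function_segment cvxh Cw Cy (ltW s0) s1.
have := hs _ s0 (lexx s); rewrite ler_distlC => /andP[_ H] H'.
rewrite -(ler_pM2l s0); lra.
Qed.

Lemma bregman_ge0 h w y :
  bregman_generator C h -> C w -> rint C y -> 0 <= bregman C h w y.
Proof.
move=> [cvxh dh] Cw ry; have [Cy _] := ry.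
rewrite subr_ge0; apply: is_rgradient_le => //.
exact/rgradientP/dh.
Qed.

Lemma is_rgradient_argmin h (a : 'rV[R]_n) (k : R) w y v :
  0 < k -> is_rgradient C h y v ->
  is_argmin C (fun z => dotv a z + k * h z) y -> C w ->
  0 <= dotv a (w - y) + k * dotv v (w - y).
Proof.
move=> k0 hv [Cy miny] Cw; apply/ler_addgt0Pr => e e0.
(* Tolerance [e / k], because the expansion of [h] gets multiplied by [k]. *)
have [s [s0 s1 hs]] := is_rgradient_dir hv Cw Cy (divr_gt0 e0 k0).
have := miny _ (convex_set_segment Cw Cy (ltW s0) s1).
rewrite dotvDr dotvZr => H1.
have := hs _ s0 (lexx s); rewrite ler_distlC => /andP[+ _].
rewrite -(ler_pM2l k0) => H2.
have ke : k * (s * (e / k)) = s * e.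
  by rewrite mulrCA [k * _]mulrC divfK// gt_eqF.
rewrite -(ler_pM2l s0); lra.
Qed.

(* Since [dotv (rgradient h y - rgradient h c) (w - y)] equals
   [bregman w c - bregman w y - bregman y c], this is the first-order
   optimality condition at [y]. *)
Lemma argmin_bregman_le h (a c : 'rV[R]_n) (k : R) w y :
  0 < k -> bregman_generator C h -> rint C c -> rint C y ->
  is_argmin C (fun z => dotv a (z - c) + k * bregman C h z c) y -> C w ->
  dotv a (y - w) <= k * (bregman C h w c - bregman C h w y - bregman C h y c).
Proof.
move=> k0 [_ dh] rc ry [Cy miny] Cw.
(* Up to a constant in [z], the proximal objective is [k * h] plus a linear form that absorbs the
   gradient of [h] at [c]. *)
have miny' : is_argmin C
    (fun z => dotv (a - k *: rgradient C h c) z + k * h z) y.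
  split=> // z Cz; have := miny z Cz.
  by rewrite /bregman !dotvDl !dotvNl !dotvZl !dotvBr; lra.
have := is_rgradient_argmin k0 (rgradientP (dh _ ry)) miny' Cw.
by rewrite /bregman dotvDl !dotvNl !dotvZl !dotvBr; lra.
Qed.

End Convex.

Theorem theorem3p4 (R : realType) (n m : nat)
  (X : set 'rV[R]_n) (Y : set 'rV[R]_m)
  (cptX : compact X) (cvxX : convex_set X)
  (cptY : compact Y) (cvxY : convex_set Y)
  (g : 'rV[R]_n -> R) (h : 'rV[R]_m -> R)
  (gB : bregman_generator X g) (hB : bregman_generator Y h)
  (f : 'rV[R]_n -> 'rV[R]_m -> R)
  (fdiff : forall x y, rint X x -> rint Y y ->
     rdifferentiable (pairset X Y) (joint f) (row_mx x y))
  (LX LY : R) (fcc : convex_concave_wrt X Y g h LX LY f)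
  (xs : 'rV[R]_n) (ys : 'rV[R]_m) (sp : saddle_point X Y f xs ys)
  (x : nat -> 'rV[R]_n) (y : nat -> 'rV[R]_m)
  (xrint : forall t, rint X (x t)) (yrint : forall t, rint Y (y t))
  (xstep : forall t, is_argmin X
     (fun w => dotv (rgradient X (fun u => f u (y t)) (x t)) (w - x t)
               + 2 * LX * bregman X g w (x t)) (x t.+1))
  (ystep : forall t, is_argmin Y
     (fun w => dotv (- rgradient Y (fun v => f (x t) v) (y t)) (w - y t)
               + 2 * LY * bregman Y h w (y t)) (y t.+1))
  (T : nat) (T_ge1 : (1 <= T)%N) :
  \sum_(1 <= t < T.+1) (f (x t) ys - f xs (y t))
    <= 2 * LX * bregman X g xs (x 0%N) + 2 * LY * bregman Y h ys (y 0%N)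
  /\
  f (T%:R^-1 *: \sum_(1 <= t < T.+1) x t) ys
    - f xs (T%:R^-1 *: \sum_(1 <= t < T.+1) y t)
    <= T%:R^-1 * (2 * LX * bregman X g xs (x 0%N)
                  + 2 * LY * bregman Y h ys (y 0%N)).
Proof.
have [cvxf ccvf LX0 LY0 fbound] := fcc; have [Xxs Yys _] := sp.
have Xx t : X (x t) by case: (xrint t).
have Yy t : Y (y t) by case: (yrint t).
pose D t : R := 2 * LX * bregman X g xs (x t) + 2 * LY * bregman Y h ys (y t).
have LX20 : 0 < 2 * LX by rewrite mulr_gt0.
have LY20 : 0 < 2 * LY by rewrite mulr_gt0.
have D0 t : 0 <= D t.
  by rewrite addr_ge0// mulr_ge0 ?(ltW LX20) ?(ltW LY20)//; apply: bregman_ge0.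
have step t : f (x t.+1) ys - f xs (y t.+1) <= D t - D t.+1.
  set v := rgradient (pairset X Y) (joint f) (row_mx (x t) (y t)).
  have gv : is_rgradient (pairset X Y) (joint f) (row_mx (x t) (y t)) v.
    exact/rgradientP/fdiff.
  have gvX := is_rgradient_joint_l (Yy t) gv.
  have gvY := is_rgradient_joint_r (Xx t) gv.
  (* The updates use gradients of the slices, while [fbound] uses the joint gradient [v]; the two
     agree along feasible directions. *)
  have gX w : X w -> dotv (rgradient X (f^~ (y t)) (x t)) (w - x t) =
                     dotv (lsubmx v) (w - x t).
    move=> Xw; apply: (is_rgradient_unique cvxX _ gvX) => //.
    by apply: rgradientP; exists (lsubmx v).
  have gY w : Y w -> dotv (rgradient Y (f (x t)) (y t)) (w - y t) =
                     dotv (rsubmx v) (w - y t).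
    move=> Yw; apply: (is_rgradient_unique cvxY _ gvY) => //.
    by apply: rgradientP; exists (rsubmx v).
  have /andP[_ up] := fbound _ _ _ _ (Xx t.+1) Yys (xrint t) (yrint t).
  have /andP[lo _] := fbound _ _ _ _ Xxs (Yy t.+1) (xrint t) (yrint t).
  have hx := argmin_bregman_le cvxX LX20 gB (xrint t) (xrint t.+1) (xstep t) Xxs.
  have hy := argmin_bregman_le cvxY LY20 hB (yrint t) (yrint t.+1) (ystep t) Yys.
  (* Smoothness costs [LX] times this divergence and optimality returns [2 * LX] times it; the
     surplus is dropped by nonnegativity. *)
  have bX := mulr_ge0 (ltW LX0) (bregman_ge0 cvxX gB (Xx t.+1) (xrint t)).
  have bY := mulr_ge0 (ltW LY0) (bregman_ge0 cvxY hB (Yy t.+1) (yrint t)).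
  move: (gX _ (Xx t.+1)) (gX _ Xxs) (gY _ (Yy t.+1)) (gY _ Yys) up lo hx hy.
  rewrite -/v !opp_row_mx !add_row_mx !dotv_row_mx /D.
  rewrite dotvNl !dotvBr.
  lra.
have sum_le : \sum_(1 <= t < T.+1) (f (x t) ys - f xs (y t)) <= D 0%N.
  rewrite big_add1/=.
  apply: (@le_trans _ _ (\sum_(0 <= t < T) (D t - D t.+1))).
    by apply: ler_sum => t _; exact: step.
  (* The signs are flipped to fit [telescope_sumr]; the sum is [D 0 - D T], and [D T] is
     nonnegative. *)
  rewrite -[leLHS]opprK -sumrN.
  under eq_bigr do rewrite opprB.
  by rewrite telescope_sumr// opprB gerBl.
split=> //; case: T T_ge1 sum_le => // N _.
rewrite !big_add1/= !big_mkord sumrB => sum_le.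
have [_ hf] := convex_mean cvxX N (cvxf _ Yys) (fun t => Xx t.+1).
(* Concavity in the second argument enters as convexity of [- f xs], so the two Jensen bounds add up
   to the averaged gap. *)
have [_ hF] := convex_mean cvxY N (ccvf _ Xxs) (fun t => Yy t.+1).
apply: (le_trans (lerD hf hF)).
by rewrite sumrN -mulrDr ler_wpM2l ?invr_ge0.
Qed.
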